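(* Every primitive hidden stochastic game satisfies the Doeblin condition, with an explicit mapping $\varepsilon\mapsto(m_\varepsilon,\delta_\varepsilon)$.
   Context: $\mathbb N^*=\{1,2,\dots\}$; $\Delta(C)$ is the set of probability distributions on a finite set $C$; $\|b\|_1=\sum_k|b(k)|$. Hidden stochastic game. A (two-player zero-sum) hidden stochastic game is a tuple $\Gamma=(\mathcal K,\mathcal I,\mathcal J,\mathcal S,p,g)$ with finite sets of states $\mathcal K$, actions $\mathcal I$ (Player 1) and $\mathcal J$ (Player 2), signals $\mathcal S$, a transition function $p:\mathcal K\times\mathcal I\times\mathcal J\to\Delta(\mathcal K\times\mathcal S)$ and a reward function $g:\mathcal K\times\mathcal I\times\mathcal J\to[0,1]$. Given an initial belief $b_1\in\Delta(\mathcal K)$, known to both players, the initial state $K_1$ is drawn from $b_1$ and not observed. At each stage $m\ge1$ the players simultaneously choose actions $I_m,J_m$; the reward $g(K_m,I_m,J_m)$ is generated (unobserved); then $(K_{m+1},S_{m+1})$ is drawn from $p(K_m,I_m,J_m)$, and both players observe $(I_m,J_m,S_{m+1})$ but not $K_{m+1}$. Histories before stage $m$: $\mathcal H_m=(\mathcal I\times\mathcal J\times\mathcal S)^{m-1}$, with $\mathcal H_1=\{\emptyset\}$. Strategies: $\sigma:\bigcup_{m\ge1}\mathcal H_m\to\Delta(\mathcal I)$ for Player 1 (set $\Sigma$), $\tau:\bigcup_{m\ge1}\mathcal H_m\to\Delta(\mathcal J)$ for Player 2 (set $\mathcal T$). $\mathbb P^{b_1}_{\sigma,\tau}$ is the induced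 probability on plays, $H_m=(I_1,J_1,S_2,\dots,I_{m-1},J_{m-1},S_m)$, and $B_m(\cdot)=\mathbb P^{b_1}_{\sigma,\tau}(K_m=\cdot\mid H_m)$ is the random belief at stage $m$. Doeblin condition. $\Gamma$ is Doeblin if for every $\varepsilon>0$ there exist $m_\varepsilon\in\mathbb N^*$ and $\delta_\varepsilon>0$ such that for all $(\sigma,\tau)\in\Sigma\times\mathcal T$ there exists $\overline b\in\Delta(\mathcal K)$ such that for all $b\in\Delta(\mathcal K)$, $\mathbb P^b_{\sigma,\tau}(\|B_{m_\varepsilon}-\overline b\|_1\le\varepsilon)\ge\delta_\varepsilon$. The mapping $\varepsilon\mapsto(m_\varepsilon,\delta_\varepsilon)$ in the claim refers to these parameters. Primitive hidden stochastic game. For $(i,j,s)\in\mathcal I\times\mathcal J\times\mathcal S$ let $P(i,j,s)$ be the $\mathcal K\times\mathcal K$ matrix with entries $P_{k,k'}(i,j,s)=p(k,i,j)(k',s)$, and for $h_m=(i_1,j_1,s_2,\dots,i_{m-1},j_{m-1},s_m)\in\mathcal H_m$ let $T(h_m)=P(i_1,j_1,s_2)P(i_2,j_2,s_3)\cdots P(i_{m-1},j_{m-1},s_m)$. For a nonnegative $\mathcal K\times\mathcal K$ matrix $P$, put $\tau_p(P)=1$ if the minimum entry of $P$ is zero, and otherwise $$\tau_p(P)=\frac{1-\psi(P)^{1/2}}{1+\psi(P)^{1/2}},\qquad \psi(P)=\min_{k,\overline k,k',k''\in\mathcal K}\frac{P_{k,k'}P_{\overline k,k''}}{P_{\overline k,k'}P_{k,k''}}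 .$$ A hidden stochastic game is primitive if for all $\varepsilon>0$ there exists an integer $m_\varepsilon\in\mathbb N^*$ such that $\tau_p(T(h_{m_\varepsilon}))\le\varepsilon$ for all $h_{m_\varepsilon}\in\mathcal H_{m_\varepsilon}$. *)

(* Defs.v *)
From HB Require Import structures.
From mathcomp Require Import all_boot all_order all_algebra.
From mathcomp Require Import classical_sets reals.

Set Implicit Arguments.
Unset Strict Implicit.
Unset Printing Implicit Defensive.

Import Order.TTheory GRing.Theory Num.Theory.
Local Open Scope ring_scope.

Record dist (R : realType) (C : finType) := Dist {
  dist_fun :> C -> R;
  dist_ge0 : forall c, 0 <= dist_fun c;
  dist_sum1 : \sum_c dist_fun c = 1
}.

Definition Pr (R : realType) (C : finType) (d : dist R C) (E : pred C) : R :=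
  \sum_(c | E c) d c.

(* Conditional probability; it is 0 when E has probability 0. *)
Definition cPr (R : realType) (C : finType) (d : dist R C) (F E : pred C) : R :=
  Pr d (predI F E) / Pr d E.

Definition norm1 (R : realType) (C : finType) (f : C -> R) : R :=
  \sum_c `|f c|.

(* On a nonempty finite type the infimum is attained. *)
Definition minval (R : realType) (C : finType) (F : C -> R) : R :=
  inf [set F c | c in [set: C]]%classic.

Record hsg (R : realType) (K I J S : finType) := Hsg {
  states_gt0 : (0 < #|K|)%N;
  actions1_gt0 : (0 < #|I|)%N;
  actions2_gt0 : (0 < #|J|)%N;
  trans : K -> I -> J -> dist R (K * S)%type;
  reward : K -> I -> J -> R;
  reward01 : forall k i j, 0 <= reward k i j <= 1
}.

(* Histories before stage m >= 1: the m - 1 observed triples (I_t, J_t, S_t+1). *)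
Definition history (I J S : finType) (m : nat) := (m.-1).-tuple (I * J * S)%type.

(* The union of the sets of histories over m is the type of finite sequences. *)
Definition strategy (R : realType) (I J S A : finType) :=
  seq (I * J * S)%type -> dist R A.

(* Plays up to the beginning of stage m >= 1: the initial state K_1, followed by
   the m - 1 items ((I_t, J_t), (K_t+1, S_t+1)). *)
Definition play (K I J S : finType) (m : nat) :=
  (K * (m.-1).-tuple (I * J * (K * S)))%type.

Section Law.

Context (R : realType) (K I J S : finType) (G : hsg R K I J S).
Context (sigma : strategy R I J S I) (tau : strategy R I J S J).

Fixpoint cont_prob (h : seq (I * J * S)) (k : K) (w : seq (I * J * (K * S))) : R :=
  if w is ((i, j), (k', s)) :: w' then
    sigma h i * tau h j * trans G k i j (k', s)
      * cont_prob (rcons h (i, j, s)) k' w'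
  else 1.

Definition play_prob (b : dist R K) (m : nat) (x : play K I J S m) : R :=
  b x.1 * cont_prob [::] x.1 x.2.

Lemma cont_prob_ge0 h k w : 0 <= cont_prob h k w.
Proof.
elim: w h k => [|[[i j] [k' s]] w IHw] h k //=.
by rewrite !mulr_ge0 ?dist_ge0.
Qed.

Lemma cont_prob_sum1 n h k :
  \sum_(w : n.-tuple (I * J * (K * S))) cont_prob h k w = 1.
Proof.
elim: n h k => [|n IHn] h k.
  rewrite (eq_bigr (fun=> 1)) => [|w _]; last by rewrite tuple0.
  by rewrite sumr_const card_tuple expn0.
pose f (q : (I * J * (K * S)) * n.-tuple (I * J * (K * S))) := [tuple of q.1 :: q.2].
have f_bij : bijective f.
  exists (fun t : n.+1.-tuple _ => (thead t, [tuple of behead t])).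
    by case=> a w; congr pair; apply/val_inj.
  by move=> t; rewrite /f /= -tuple_eta.
rewrite (reindex f) /=; last exact/onW_bij.
rewrite -(pair_bigA _ (fun a (w : n.-tuple _) => cont_prob h k (a :: w))) /=.
rewrite (eq_bigr (fun a : I * J * (K * S) =>
  sigma h a.1.1 * tau h a.1.2 * trans G k a.1.1 a.1.2 a.2)); last first.
  by move=> [[i j] [k' s]] _ /=; rewrite -mulr_sumr IHn mulr1.
rewrite -(pair_bigA _ (fun (a : I * J) (c : K * S) =>
  sigma h a.1 * tau h a.2 * trans G k a.1 a.2 c)) /=.
rewrite (eq_bigr (fun a : I * J => sigma h a.1 * tau h a.2)); last first.
  by move=> a _; rewrite -mulr_sumr dist_sum1 mulr1.
rewrite -(pair_bigA _ (fun i j => sigma h i * tau h j)) /=.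
rewrite (eq_bigr (sigma h)) ?dist_sum1 // => i _.
by rewrite -mulr_sumr dist_sum1 mulr1.
Qed.

Lemma play_prob_ge0 b m x : 0 <= play_prob b (m := m) x.
Proof. by rewrite mulr_ge0 ?dist_ge0 ?cont_prob_ge0. Qed.

Lemma play_prob_sum1 b m : \sum_x play_prob b (m := m) x = 1.
Proof.
rewrite -(pair_bigA _ (fun k (w : (m.-1).-tuple _) => b k * cont_prob [::] k w)) /=.
rewrite (eq_bigr b) ?dist_sum1 // => k _.
by rewrite -mulr_sumr cont_prob_sum1 mulr1.
Qed.

(* Marginal, on the plays up to the beginning of stage m, of the probability
   induced on infinite plays by b, sigma and tau. *)
Definition law (b : dist R K) (m : nat) : dist R (play K I J S m) :=
  Dist (play_prob_ge0 b (m := m)) (play_prob_sum1 b m).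

Definition state_at (m : nat) (x : play K I J S m) : K :=
  last x.1 [seq a.2.1 | a <- x.2].

Definition history_at (m : nat) (x : play K I J S m) : history I J S m :=
  [tuple of [seq (a.1, a.2.2) | a <- x.2]].

Definition belief (b : dist R K) (m : nat) (x : play K I J S m) (k : K) : R :=
  cPr (law b m) [pred y | state_at y == k] [pred y | history_at y == history_at x].

End Law.

Definition doeblin_at (R : realType) (K I J S : finType) (G : hsg R K I J S)
    (eps : R) (m : nat) (delta : R) : Prop :=
  [/\ (0 < m)%N, 0 < delta &
    forall (sigma : strategy R I J S I) (tau : strategy R I J S J),
    exists b0 : dist R K, forall b : dist R K,
      delta <= Pr (law G sigma tau b m)
        [pred x | norm1 (fun k => belief G sigma tau b x k - b0 k) <= eps]].

Definition doeblin (R : realType) (K I J S : finType) (G : hsg R K I J S) : Prop :=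
  forall eps : R, 0 < eps -> exists m delta, doeblin_at G eps m delta.

Definition doeblin_mapping (R : realType) (K I J S : finType) (G : hsg R K I J S)
    (f : R -> nat * R) : Prop :=
  forall eps : R, 0 < eps -> doeblin_at G eps (f eps).1 (f eps).2.

(* Rows and columns of a K x K matrix are numbered by the enumeration of K. *)

Definition signal_mx (R : realType) (K I J S : finType) (G : hsg R K I J S)
    (a : I * J * S) : 'M[R]_#|K| :=
  \matrix_(r, c) trans G (enum_val r) a.1.1 a.1.2 (enum_val c, a.2).

Definition history_mx (R : realType) (K I J S : finType) (G : hsg R K I J S)
    (h : seq (I * J * S)) : 'M[R]_#|K| :=
  \prod_(a <- h) signal_mx G a.

Definition psi (R : realType) (n : nat) (P : 'M[R]_n) : R :=
  minval (fun q : 'I_n * 'I_n * 'I_n * 'I_n =>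
    let: (k, l, k', k'') := q in (P k k' * P l k'') / (P l k' * P k k'')).

Definition tau_p (R : realType) (n : nat) (P : 'M[R]_n) : R :=
  if minval (fun q : 'I_n * 'I_n => P q.1 q.2) == 0 then 1
  else (1 - Num.sqrt (psi P)) / (1 + Num.sqrt (psi P)).

Definition primitive_at (R : realType) (K I J S : finType) (G : hsg R K I J S)
    (eps : R) (m : nat) : Prop :=
  (0 < m)%N /\ forall h : history I J S m, tau_p (history_mx G h) <= eps.

Definition primitive (R : realType) (K I J S : finType) (G : hsg R K I J S) : Prop :=
  forall eps : R, 0 < eps -> exists m, primitive_at G eps m.

Definition primitive_mapping (R : realType) (K I J S : finType)
    (G : hsg R K I J S) (mu : R -> nat) : Prop :=
  forall eps : R, 0 < eps -> primitive_at G eps (mu eps).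

Definition min_trans (R : realType) (K I J S : finType) (G : hsg R K I J S) : R :=
  inf [set x : R | 0 < x /\ exists k i j c, x = trans G k i j c]%classic.

(* The bound |b P / |b P| - b' P / |b' P||_1 <= 2 tau_p(P), for b and b' in the
   simplex and P positive, explains eps / 2. A history of length m - 1 in which
   each action has conditional probability at least 1/#|I|, resp. 1/#|J|, and whose
   matrix is positive has probability at least the second component, whatever the
   initial belief. *)
Definition doeblin_params (R : realType) (K I J S : finType)
    (G : hsg R K I J S) (mu : R -> nat) (eps : R) : nat * R :=
  let m := mu (eps / 2) in (m, (min_trans G / (#|I| * #|J|)%N%:R) ^+ m.-1).

(* Main.v *)
Require Import Defs.
From mathcomp Require Import all_boot all_order all_algebra.
From mathcomp Require Import classical_sets reals.
From mathcomp Require Import ring lra.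

Set Implicit Arguments.
Unset Strict Implicit.
Unset Printing Implicit Defensive.

Import Order.TTheory GRing.Theory Num.Theory.
Local Open Scope ring_scope.

(** If two probability vectors u, v satisfy r^2 u(c) v(c') <= u(c') v(c), their
    l1-distance is at most 2 (1 - r) / (1 + r). The normalized images of any two
    beliefs under a positive matrix P satisfy this with r^2 = psi(P), so they are
    within 2 tau_p(P) of each other. Given strategies, follow a history h along which
    every action is played with probability at least 1/#|I|, resp. 1/#|J|. The
    posterior after h is b T(h) / |b T(h)|, which depends on b up to 2 tau_p(T(h))
    only, and every positive entry of T(h) is a sum of products of positive transition
    probabilities, so h has a probability bounded below uniformly in b. For
    eps >= 2 the matrices T(h) may vanish, but the l1-ball of radius eps is then the
    whole simplex. *)

(** * Cross-ratios and the l1-distance of probability vectors *)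

Section Contraction.

Context (R : realType).

(** Let d = x - y > 0, the other case being immediate. Then x (1 - y) = y (1 - x) + d, and y (1 - x)
    <= ((1 - d) / 2)^2 because its two factors sum to 1 - d. Hence r^2 (1 + d)^2 <= (1 - d)^2; take
    square roots. *)
Lemma diff_le_of_odds (r x y : R) : 0 <= r -> r <= 1 -> 0 <= x <= 1 -> 0 <= y <= 1 ->
  r ^+ 2 * (x * (1 - y)) <= y * (1 - x) -> x - y <= (1 - r) / (1 + r).
Proof.
move=> r_ge0 r_le1 /andP[x0 x1] /andP[y0 y1] odds.
rewrite ler_pdivlMr; last by lra.
have [dle0|dgt0] := lerP (x - y) 0; first by nra.
have amgm : 4 * (y * (1 - x)) <= (1 - (x - y)) ^+ 2.
  rewrite -subr_ge0; have -> : (1 - (x - y)) ^+ 2 - 4 * (y * (1 - x)) = (1 - x - y) ^+ 2 by ring.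
  exact: sqr_ge0.
have r2 : 0 <= 1 - r ^+ 2 by nra.
have : (r * (1 + (x - y))) ^+ 2 <= (1 - (x - y)) ^+ 2.
  have := ler_wpM2r r2 amgm; nra.
rewrite ler_pXn2r ?nnegrE //; [nra | nra | lra].
Qed.

Context (C : finType).
Implicit Types u v : C -> R.

Lemma norm1_distB u v : \sum_c u c = 1 -> \sum_c v c = 1 ->
  norm1 (fun c => u c - v c) = 2 * (\sum_(c | v c <= u c) u c - \sum_(c | v c <= u c) v c).
Proof.
move=> u1 v1; rewrite /norm1 (bigID (fun c => v c <= u c)) /=.
rewrite (eq_bigr (fun c => u c - v c)); last by move=> c vu; rewrite ger0_norm ?subr_ge0.
rewrite [X in _ + X](eq_bigr (fun c => v c - u c)); last first.
  by move=> c; rewrite -ltNge => uv; rewrite ltr0_norm ?subr_lt0 ?opprB.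
rewrite !sumrB.
move: u1 v1; rewrite (bigID (fun c => v c <= u c)) /=.
rewrite (bigID (fun c => v c <= u c) _ v) /=; lra.
Qed.

(** Serves for eps >= 2. Sums below 1 are allowed because [cPr] makes the belief after a null
    history the zero vector. *)
Lemma norm1_distB_le2 u v : (forall c, 0 <= u c) -> (forall c, 0 <= v c) ->
  \sum_c u c <= 1 -> \sum_c v c <= 1 -> norm1 (fun c => u c - v c) <= 2.
Proof.
move=> u0 v0 u1 v1; apply: (@le_trans _ _ (\sum_c (u c + v c))); last first.
  by rewrite big_split /=; lra.
by apply: ler_sum => c _; rewrite (le_trans (ler_normB _ _)) // !ger0_norm.
Qed.

(** For A = {v <= u}, the gap u(A) - v(A) is half the distance. Summing the cross-ratio bound over c
    in A and c' outside A gives the odds inequality for x = u(A) and y = v(A). *)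
Lemma norm1_le_of_cross_ratio (r : R) u v : 0 <= r -> r <= 1 ->
  (forall c, 0 <= u c) -> (forall c, 0 <= v c) ->
  \sum_c u c = 1 -> \sum_c v c = 1 ->
  (forall c c', r ^+ 2 * (u c * v c') <= u c' * v c) ->
  norm1 (fun c => u c - v c) <= 2 * ((1 - r) / (1 + r)).
Proof.
move=> r0 r1 u0 v0 u1 v1 cross; rewrite norm1_distB // ler_pM2l //.
have split (w : C -> R) : \sum_c w c = 1 ->
    1 - \sum_(c | v c <= u c) w c = \sum_(c | ~~ (v c <= u c)) w c.
  by rewrite (bigID (fun c => v c <= u c)) /=; lra.
have bounds (w : C -> R) : (forall c, 0 <= w c) -> \sum_c w c = 1 ->
    0 <= \sum_(c | v c <= u c) w c <= 1.
  by move=> w0 w1; rewrite sumr_ge0 //= -subr_ge0 split // sumr_ge0.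
apply: diff_le_of_odds; rewrite ?bounds // !split //.
rewrite !big_distrlr /= mulr_sumr; apply: ler_sum => c _.
rewrite mulr_sumr; apply: ler_sum => c' _.
by rewrite [leRHS]mulrC.
Qed.

End Contraction.

(** * Minima, [psi] and [tau_p] for nonnegative matrices *)

Section Minval.

Context (R : realType) (C : finType) (F : C -> R).
Context (F_ge0 : forall c, 0 <= F c).

Let minval_has_lbound : has_lbound [set F c | c in [set: C]]%classic.
Proof. by exists 0 => _ [c _ <-]. Qed.

Lemma minval_le c : minval F <= F c.
Proof. by apply: ge_inf => //; exists c. Qed.

Lemma minval_ge0 : 0 <= minval F.
Proof.
have [c _|C0] := pickP C.
  by apply: lb_le_inf; [exists (F c), c | move=> _ [c' _ <-]].
(* On an empty type the infimum is 0 by convention. *)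
rewrite /minval inf_out // => -[[_ [c _ _]] _].
by have := C0 c.
Qed.

Lemma minval_neq0_gt0 c : minval F != 0 -> 0 < F c.
Proof.
by move=> F0; apply: lt_le_trans (minval_le c); rewrite lt_def F0 minval_ge0.
Qed.

End Minval.

Section TauP.

Context (R : realType) (n : nat) (P : 'M[R]_n).
Context (P_ge0 : forall k l, 0 <= P k l).

(** A zero minimum entry gives the value 1, so a value below 1 excludes it. *)
Lemma tau_p_lt1_gt0 k l : tau_p P < 1 -> 0 < P k l.
Proof.
rewrite /tau_p; case: eqP => [_|/eqP P0 _]; first by rewrite ltxx.
exact: (@minval_neq0_gt0 _ _ (fun q : 'I_n * 'I_n => P q.1 q.2) _ (k, l)).
Qed.

Lemma psi_le k l k' k'' : psi P <= (P k k' * P l k'') / (P l k' * P k k'').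
Proof.
apply: (@minval_le _ _ _ _ (k, l, k', k'')) => -[[[a b] c] d].
by rewrite divr_ge0 ?mulr_ge0.
Qed.

Lemma psi_ge0 : 0 <= psi P.
Proof.
by apply: minval_ge0 => -[[[a b] c] d]; rewrite divr_ge0 ?mulr_ge0.
Qed.

End TauP.

(** * Finite probability distributions *)

Lemma dist_gt0 (R : realType) (C : finType) (d : dist R C) : exists c, 0 < d c.
Proof.
apply/existsP; rewrite -[[exists _, _]]negbK negb_exists; apply/negP => /forallP d0.
have := dist_sum1 d; rewrite big1 => [|c _]; first by move/eqP; rewrite eq_sym oner_eq0.
by apply/eqP; rewrite eq_le dist_ge0 andbT leNgt d0.
Qed.

Lemma dist_ge_inv_card (R : realType) (C : finType) (d : dist R C) :
  exists c, #|C|%:R^-1 <= d c.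
Proof.
have [c0 _] := dist_gt0 d.
have C0 : (0 < #|C|)%N by apply/card_gt0P; exists c0.
apply/existsP; rewrite -[[exists _, _]]negbK negb_exists; apply/negP => /forallP dlt.
suff : \sum_c d c < \sum_(c : C) #|C|%:R^-1.
  by rewrite dist_sum1 sumr_const -[_ *+ _]mulr_natl mulfV ?ltxx // pnatr_eq0 -lt0n.
apply: ltr_sum; first by apply/hasP; exists c0; rewrite ?mem_index_enum.
by move=> c _; rewrite ltNge dlt.
Qed.

Lemma dist_le1 (R : realType) (C : finType) (d : dist R C) c : d c <= 1.
Proof. by rewrite -(dist_sum1 d) (bigD1 c) //= lerDl sumr_ge0 // => ? _; apply: dist_ge0. Qed.

Lemma Pr_ge0 (R : realType) (C : finType) (d : dist R C) (E : pred C) : 0 <= Pr d E.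
Proof. by apply: sumr_ge0 => c _; apply: dist_ge0. Qed.

Lemma Pr_sub (R : realType) (C : finType) (d : dist R C) (E F : pred C) :
  subpred E F -> Pr d E <= Pr d F.
Proof.
move=> EF; rewrite /Pr [leRHS](bigID E) /=.
rewrite [X in _ <= X + _](eq_bigl E); last first.
  by move=> c; rewrite andbC; case: (boolP (E c)) => // /EF.
by rewrite lerDl; apply: sumr_ge0 => c _; apply: dist_ge0.
Qed.

Lemma dist_normalize (R : realType) (C : finType) (f : C -> R) :
  (forall c, 0 <= f c) -> 0 < \sum_c f c ->
  exists d : dist R C, forall c, d c = f c / \sum_c f c.
Proof.
move=> f0 s0.
have d0 c : 0 <= f c / \sum_c f c by rewrite divr_ge0 ?f0 ?ltW.
have d1 : \sum_c f c / \sum_c f c = 1 by rewrite -mulr_suml divff ?gt_eqF.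
by exists (Dist d0 d1).
Qed.

Lemma big_tuple_cons (R : realType) (A : finType) n (P : pred (seq A)) (F : seq A -> R) :
  \sum_(w : n.+1.-tuple A | P w) F w =
  \sum_a \sum_(w : n.-tuple A | P (a :: w)) F (a :: w).
Proof.
pose f (q : A * n.-tuple A) := [tuple of q.1 :: q.2].
have f_bij : bijective f.
  exists (fun t : n.+1.-tuple _ => (thead t, [tuple of behead t])).
    by case=> a w; congr pair; apply/val_inj.
  by move=> t; rewrite /f /= -tuple_eta.
rewrite (reindex f) /=; last exact/onW_bij.
by rewrite pair_big_dep.
Qed.

(** * History matrices and their action on beliefs *)

Section Game.

Context (R : realType) (K I J S : finType) (G : hsg R K I J S).

(** Indexed by states instead of ranks: the probability, from state k and with the actions of h
    imposed, of seeing the signals of h and ending in k'. *)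
Definition trans_mx (h : seq (I * J * S)) (k k' : K) : R :=
  history_mx G h (enum_rank k) (enum_rank k').

Lemma trans_mx_nil k k' : trans_mx [::] k k' = (k == k')%:R.
Proof.
by rewrite /trans_mx /history_mx big_nil -[1]/(1%:M) mxE (inj_eq enum_rank_inj).
Qed.

Lemma trans_mx_cons a h k k' :
  trans_mx (a :: h) k k' =
  \sum_l trans G k a.1.1 a.1.2 (l, a.2) * trans_mx h l k'.
Proof.
rewrite /trans_mx /history_mx big_cons -[_ * _]/(_ *m _) mxE.
rewrite (reindex _ (onW_bij _ (@enum_rank_bij K))) /=; apply: eq_bigr => l _.
by rewrite mxE !enum_rankK.
Qed.

Lemma trans_mx_ge0 h k k' : 0 <= trans_mx h k k'.
Proof.
elim: h k => [|a h IH] k; first by rewrite trans_mx_nil ler0n.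
by rewrite trans_mx_cons sumr_ge0 // => l _; rewrite mulr_ge0 ?dist_ge0.
Qed.

Lemma history_mxE h r c : history_mx G h r c = trans_mx h (enum_val r) (enum_val c).
Proof. by rewrite /trans_mx !enum_valK. Qed.

Lemma min_trans_le k i j c : 0 < trans G k i j c -> min_trans G <= trans G k i j c.
Proof.
move=> pos; apply: ge_inf; last by split=> //; exists k, i, j, c.
by exists 0 => x [/ltW].
Qed.

Lemma trans_gt0_ex : exists k i j c, 0 < trans G k i j c.
Proof.
have /card_gt0P[k _] := states_gt0 G; have /card_gt0P[i _] := actions1_gt0 G.
have /card_gt0P[j _] := actions2_gt0 G; have [c pos] := dist_gt0 (trans G k i j).
by exists k, i, j, c.
Qed.

Lemma min_trans_gt0 : 0 < min_trans G.
Proof.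
have [k [i [j [c pos]]]] := trans_gt0_ex.
pose f (q : K * I * J * (K * S)) := trans G q.1.1.1 q.1.1.2 q.1.2 q.2.
case: (@arg_minP _ _ _ (k, i, j, c) (fun q => 0 < f q) f pos) => q q0 q_min.
apply: (lt_le_trans q0); apply: lb_le_inf.
  by exists (f (k, i, j, c)); split=> //; exists k, i, j, c.
by move=> x [x_gt0 [k' [i' [j' [c' def_x]]]]]; subst x; apply: (q_min (k', i', j', c')).
Qed.

Lemma min_trans_le1 : min_trans G <= 1.
Proof.
have [k [i [j [c pos]]]] := trans_gt0_ex.
exact: le_trans (min_trans_le pos) (dist_le1 _ _).
Qed.

(** A positive entry contains a path all of whose factors are positive, and each factor is at least
    [min_trans G]. *)
Lemma trans_mx_ge_min_trans h k k' :
  0 < trans_mx h k k' -> min_trans G ^+ size h <= trans_mx h k k'.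
Proof.
elim: h k => [|a h IH] k; first by rewrite trans_mx_nil; case: (k == k'); rewrite ?ltxx.
have term0 l : 0 <= trans G k a.1.1 a.1.2 (l, a.2) * trans_mx h l k'.
  by rewrite mulr_ge0 ?dist_ge0 ?trans_mx_ge0.
rewrite trans_mx_cons => sum0.
have [l] : exists l, 0 < trans G k a.1.1 a.1.2 (l, a.2) * trans_mx h l k'.
  apply/existsP; apply: contraLR sum0; rewrite negb_exists => /forallP all0.
  by rewrite -leNgt sumr_le0 // => l _; rewrite leNgt all0.
rewrite lt0r mulf_eq0 negb_or => /andP[/andP[t0 m0] _].
rewrite (bigD1 l) //= -[leLHS]addr0 exprS lerD ?sumr_ge0 //.
apply: ler_pM; rewrite ?exprn_ge0 ?(ltW min_trans_gt0) //.
- by rewrite min_trans_le // lt0r t0 dist_ge0.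
- by rewrite IH // lt0r m0 trans_mx_ge0.
Qed.

(** The row vector b T(h), that is, the posterior after h before normalization. *)
Definition push (b : K -> R) (h : seq (I * J * S)) (k : K) : R :=
  \sum_l b l * trans_mx h l k.

Lemma push_ge0 (b : dist R K) h k : 0 <= push b h k.
Proof. by apply: sumr_ge0 => l _; rewrite mulr_ge0 ?dist_ge0 ?trans_mx_ge0. Qed.

(** Expanded over pairs (l, l'), both sides carry the same weight b(l) b'(l'), and [psi] compares
    the remaining matrix entries pair by pair. *)
Lemma push_cross_ratio (b b' : dist R K) h k k' :
  (forall l l', 0 < trans_mx h l l') ->
  psi (history_mx G h) * (push b h k * push b' h k') <= push b h k' * push b' h k.
Proof.
move=> pos; rewrite !big_distrlr /= mulr_sumr; apply: ler_sum => l _.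
rewrite mulr_sumr; apply: ler_sum => l' _.
have P0 r c : 0 <= history_mx G h r c by rewrite history_mxE trans_mx_ge0.
have := psi_le P0 (enum_rank l) (enum_rank l') (enum_rank k') (enum_rank k).
rewrite -!/(trans_mx _ _ _) ler_pdivlMr ?mulr_gt0 // => psi_bound.
rewrite mulrACA [leRHS]mulrACA [leLHS]mulrCA.
apply: ler_wpM2l; first by rewrite mulr_ge0 ?dist_ge0.
by rewrite [trans_mx h l k * _]mulrC.
Qed.

(** One column suffices: its entries are all at least the bound, and b averages them. *)
Lemma push_sum_ge (b : dist R K) h : (forall l l', 0 < trans_mx h l l') ->
  min_trans G ^+ size h <= \sum_k push b h k.
Proof.
move=> pos; have /card_gt0P[k0 _] := states_gt0 G.
rewrite (bigD1 k0) //= -[leLHS]addr0 lerD ?sumr_ge0 // => [|k _]; last exact: push_ge0.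
rewrite -[leLHS]mul1r -(dist_sum1 b) mulr_suml; apply: ler_sum => l _.
by apply: ler_wpM2l; rewrite ?dist_ge0 ?trans_mx_ge_min_trans.
Qed.

Lemma norm1_push_le (b b' : dist R K) h : tau_p (history_mx G h) < 1 ->
  norm1 (fun k => push b h k / \sum_l push b h l - push b' h k / \sum_l push b' h l)
    <= 2 * tau_p (history_mx G h).
Proof.
set P := history_mx G h => tau1.
have P0 r c : 0 <= P r c by rewrite /P history_mxE trans_mx_ge0.
have pos l l' : 0 < trans_mx h l l' by exact: tau_p_lt1_gt0.
have sum0 (d : dist R K) : 0 < \sum_l push d h l.
  by apply: lt_le_trans (push_sum_ge d pos); rewrite exprn_gt0 ?min_trans_gt0.
(* The quadruple with four equal indices has ratio 1. *)
have psi1 : psi P <= 1.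
  have /card_gt0P[k0 _] := states_gt0 G; set r := enum_rank k0.
  apply: le_trans (psi_le P0 r r r r) _.
  by rewrite divff // mulf_neq0 // gt_eqF // -/(trans_mx _ _ _).
have -> : tau_p P = (1 - Num.sqrt (psi P)) / (1 + Num.sqrt (psi P)).
  by move: tau1; rewrite /tau_p; case: ifP => //; rewrite ltxx.
apply: norm1_le_of_cross_ratio; rewrite ?sqrtr_ge0 //.
- by rewrite -sqrtr1 ler_sqrt.
- by move=> k; rewrite divr_ge0 ?push_ge0 // ltW.
- by move=> k; rewrite divr_ge0 ?push_ge0 // ltW.
- by rewrite -mulr_suml divff ?gt_eqF.
- by rewrite -mulr_suml divff ?gt_eqF.
(* Both sides contain the same product of normalizing constants. *)
- move=> k k'; rewrite sqr_sqrtr ?psi_ge0 // [leRHS]mulrACA [X in _ * X <= _]mulrACA [leLHS]mulrA.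
  apply: ler_wpM2r; last exact: push_cross_ratio.
  by rewrite mulr_ge0 ?invr_ge0 ?ltW.
Qed.

(** * Law of histories and beliefs under fixed strategies *)

Section Strategies.

Context (sigma : strategy R I J S I) (tau : strategy R I J S J).

(** The part of the law due to the strategies: h is the past, a the continuation. *)
Fixpoint action_prob (h a : seq (I * J * S)) : R :=
  if a is x :: a' then
    sigma h x.1.1 * tau h x.1.2 * action_prob (rcons h x) a'
  else 1.

Lemma action_prob_large n h : exists a : n.-tuple (I * J * S),
  (#|I| * #|J|)%N%:R^-1 ^+ n <= action_prob h a.
Proof.
(* Any signal s will do, since only the actions enter the bound. *)
have [_ [_ [_ [[_ s] _]]]] := trans_gt0_ex.
elim: n h => [|n IH] h; first by exists [tuple].
have [i hi] := dist_ge_inv_card (sigma h); have [j hj] := dist_ge_inv_card (tau h).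
have [a ha] := IH (rcons h (i, j, s)); exists [tuple of (i, j, s) :: a].
rewrite /= exprS ler_pM // ?invr_ge0 ?exprn_ge0 ?invr_ge0 ?ler0n //.
by rewrite natrM invfM ler_pM ?invr_ge0.
Qed.

(** Strategies see only the public history, so their factor is constant over the hidden states;
    summing these out yields the matrix product. *)
Lemma sum_cont_prob n h (a : n.-tuple (I * J * S)) k k' :
  \sum_(w : n.-tuple (I * J * (K * S)) |
        ([seq (x.1, x.2.2) | x <- w] == a) && (last k [seq x.2.1 | x <- w] == k'))
     cont_prob G sigma tau h k w
  = action_prob h a * trans_mx a k k'.
Proof.
elim: n h a k => [|n IH] h a k.
  rewrite tuple0 /= trans_mx_nil mul1r big_mkcond (eq_bigr (fun=> (k == k')%:R)).
    by rewrite sumr_const card_tuple.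
  by move=> w _; rewrite tuple0 /=; case: (k == k').
case/tupleP: a => -[[i j] s] a.
rewrite (@big_tuple_cons _ _ _ (fun w =>
  ([seq (x.1, x.2.2) | x <- w] == (i, j, s) :: a) && (last k [seq x.2.1 | x <- w] == k'))
  (cont_prob G sigma tau h k)).
rewrite (bigID (fun y => (y.1, y.2.2) == (i, j, s))) /= [X in _ + X]big1 ?addr0; last first.
  by move=> y /negbTE y_neq; rewrite big_pred0 // => w; rewrite eqseq_cons y_neq.
(* The first step must show (i, j, s), so only the next hidden state l is free. *)
rewrite (reindex_onto (fun l => ((i, j), (l, s))) (fun y => y.2.1)) /=; last first.
  by move=> [? [? ?]] /eqP[-> ->].
rewrite trans_mx_cons mulr_sumr; apply: eq_big => [l|l _]; first by rewrite !eqxx.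
under eq_bigl => w do rewrite eqseq_cons eqxx /=.
by rewrite -mulr_sumr IH /=; ring.
Qed.

Section Belief.

Context (b : dist R K) (m : nat) (h : history I J S m).

Lemma Pr_state_history k :
  Pr (law G sigma tau b m) (predI [pred y | state_at y == k] [pred y | history_at y == h])
  = action_prob [::] h * push b h k.
Proof.
rewrite /Pr /= /push mulr_sumr.
under [RHS]eq_bigr => l _ do rewrite mulrCA -sum_cont_prob mulr_sumr.
rewrite pair_big_dep /=; apply: eq_bigl => x /=.
by rewrite andbC.
Qed.

Lemma Pr_history :
  Pr (law G sigma tau b m) [pred y | history_at y == h]
  = action_prob [::] h * \sum_k push b h k.
Proof.
rewrite mulr_sumr -(eq_bigr _ (fun k _ => Pr_state_history k)) /Pr /=.
rewrite (partition_big (fun y => state_at y) predT) //=.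
by apply: eq_bigr => k _; apply: eq_bigl => x; rewrite /= andbC.
Qed.

(** By Bayes' rule; the strategy factor cancels from numerator and denominator. *)
Lemma belief_history (x : play K I J S m) k : 0 < action_prob [::] h ->
  history_at x = h ->
  belief G sigma tau b x k = push b h k / \sum_l push b h l.
Proof.
move=> act0 xh; rewrite /belief /cPr xh Pr_state_history Pr_history.
by rewrite -mulf_div divff ?mul1r ?gt_eqF.
Qed.

End Belief.

Lemma belief_ge0 b m (x : play K I J S m) k : 0 <= belief G sigma tau b x k.
Proof. by rewrite divr_ge0 ?Pr_ge0. Qed.

Lemma belief_sum_le1 b m (x : play K I J S m) : \sum_k belief G sigma tau b x k <= 1.
Proof.
rewrite -mulr_suml (eq_bigr _ (fun k _ => Pr_state_history b (history_at x) k)).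
rewrite -mulr_sumr -Pr_history.
set p := Pr _ _.
by have [->|p0] := eqVneq p 0; rewrite ?mul0r ?divff.
Qed.

End Strategies.

(** * The Doeblin bound *)

Definition history_weight := min_trans G / (#|I| * #|J|)%N%:R.

Lemma card_actions_gt0 : 0 < (#|I| * #|J|)%N%:R :> R.
Proof. by rewrite ltr0n muln_gt0 (actions1_gt0 G) (actions2_gt0 G). Qed.

Lemma history_weight_gt0 : 0 < history_weight.
Proof. by rewrite divr_gt0 ?min_trans_gt0 ?card_actions_gt0. Qed.

Lemma history_weight_le1 : history_weight <= 1.
Proof.
rewrite ler_pdivrMr ?card_actions_gt0 // mul1r (le_trans min_trans_le1) //.
by rewrite ler1n muln_gt0 (actions1_gt0 G) (actions2_gt0 G).
Qed.

Lemma doeblin_at_of_primitive (eps : R) (m : nat) :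
  primitive_at G (eps / 2) m -> doeblin_at G eps m (history_weight ^+ m.-1).
Proof.
move=> [m_gt0 tau_le]; split=> // [|sigma tau].
  by rewrite exprn_gt0 ?history_weight_gt0.
have /card_gt0P[k0 _] := states_gt0 G.
(* A point mass, used as a reference belief to define the centre of the ball. *)
have [d0 _] : exists d : dist R K, forall c, d c = (c == k0)%:R / \sum_c (c == k0)%:R.
  apply: dist_normalize => [c|]; first exact: ler0n.
  by rewrite (bigD1 k0) //= eqxx ltr_pwDl ?sumr_ge0.
have [eps_ge2|eps_lt2] := lerP 2 eps.
  exists d0 => b; apply: (@le_trans _ _ 1).
    by rewrite exprn_ile1 ?history_weight_le1 ?ltW ?history_weight_gt0.
  rewrite -[leLHS](dist_sum1 (law G sigma tau b m)); apply: Pr_sub => x _ /=.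
  apply: le_trans eps_ge2; apply: norm1_distB_le2; rewrite ?dist_sum1 ?belief_sum_le1 //.
    by move=> k; apply: belief_ge0.
  exact: dist_ge0.
(* This h depends on the strategies but not on b, as the order of quantifiers requires. *)
have [h h_prob] := action_prob_large sigma tau m.-1 [::].
have act_gt0 : 0 < action_prob sigma tau [::] h.
  by apply: lt_le_trans h_prob; rewrite exprn_gt0 ?invr_gt0 ?card_actions_gt0.
have tau_lt1 : tau_p (history_mx G h) < 1.
  by apply: le_lt_trans (tau_le h) _; lra.
have pos l l' : 0 < trans_mx h l l'.
  by apply: tau_p_lt1_gt0 => // r c; rewrite history_mxE trans_mx_ge0.
have push_sum (b : dist R K) : min_trans G ^+ m.-1 <= \sum_k push b h k.
  by have := push_sum_ge b pos; rewrite size_tuple.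
have [b0 b0E] : exists b0 : dist R K, forall k, b0 k = push d0 h k / \sum_l push d0 h l.
  apply: dist_normalize => [k|]; first exact: push_ge0.
  by apply: lt_le_trans (push_sum d0); rewrite exprn_gt0 ?min_trans_gt0.
exists b0 => b.
(* On the event that h occurs, the belief lies in the ball; its probability splits into an action
   factor and a transition factor, each over m - 1 stages. *)
apply: (@le_trans _ _ (Pr (law G sigma tau b m) [pred y | history_at y == h])).
  rewrite Pr_history expr_div_n mulrC -exprVn; apply: ler_pM => //.
  - by rewrite exprn_ge0 ?invr_ge0.
  - by rewrite exprn_ge0 ?ltW ?min_trans_gt0.
apply: Pr_sub => x /eqP xh /=.
rewrite [X in X <= _](_ : _ =
  norm1 (fun k => push b h k / \sum_l push b h l - push d0 h k / \sum_l push d0 h l)).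
  (* The factor 2 in the contraction bound cancels the halving of eps. *)
  apply: le_trans (norm1_push_le _ _ tau_lt1) _.
  by have := tau_le h; lra.
by apply: eq_bigr => k _; rewrite (belief_history _ _ act_gt0 xh) b0E.
Qed.

End Game.

Theorem theorem3p7 (R : realType) (K I J S : finType) (G : hsg R K I J S) :
  primitive G ->
  doeblin G /\
  (forall mu : R -> nat, primitive_mapping G mu ->
     doeblin_mapping G (doeblin_params G mu)).
Proof.
move=> G_prim; split=> [eps eps0|mu mu_prim eps eps0].
  have [|m prim_m] := G_prim (eps / 2); first by rewrite divr_gt0.
  by exists m, (history_weight G ^+ m.-1); apply: doeblin_at_of_primitive.
by apply: doeblin_at_of_primitive; apply: mu_prim; rewrite divr_gt0.
Qed.
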